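(* Suppose there exists a PS$(v)$ or an APS$(v,\alpha,\beta)$ (for some nonzero $\alpha,\beta\in\mathbb{Z}_v$). Then (1) there exists a maximum $(3v,4,1)$-OOC whenever $\gcd(v,6)=1$, and (2) there exists a maximum $(5v,5,1)$-OOC whenever $\gcd(v,10)=1$.
   Context: PS$(v)$ ($v\equiv1\pmod4$): a set $\mathcal S$ of $(v-1)/4$ unordered pairs from $\mathbb{Z}_v$ with $\bigcup_{\{x,y\}\in\mathcal S}\pm\{x,y\}=\mathbb{Z}_v\setminus\{0\}$ and $\bigcup_{\{x,y\}\in\mathcal S}\pm\{x-y,x+y\}=\mathbb{Z}_v\setminus\{0\}$. APS$(v,\alpha,\beta)$ ($v\equiv 3\pmod 4$, $\alpha,\beta\ne0$): a set $\mathcal S$ of $(v-3)/4$ unordered pairs from $\mathbb{Z}_v$ with $\bigcup\pm\{x,y\}=\mathbb{Z}_v\setminus\{0,\pm\alpha\}$ and $\bigcup\pm\{x-y,x+y\}=\mathbb{Z}_v\setminus\{0,\pm\beta\}$. A $(n,k,1)$-optical orthogonal code (OOC) is a set $\mathcal B$ of $k$-subsets (codewords) of $\mathbb{Z}_n$ such that the multiset $\Delta\mathcal B=\bigcup_{B\in\mathcal B}[x-y: x,y\in B, x\ne y]$ has no repeated elements; it is maximum if $|\mathbb{Z}_n\setminus\Delta\mathcal B|\le k(k-1)$. *)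

(* Defs.v *)
From mathcomp Require Import all_boot all_order all_algebra.

Set Implicit Arguments.
Unset Strict Implicit.
Unset Printing Implicit Defensive.

Import GRing.Theory.
Local Open Scope ring_scope.

(* The additive group Z_n for n > 0. It is trivial for n = 1, which 'Z_1 is   *)
(* not; n = 0 is junk and never arises below.                                 *)
Notation Zmod n := 'I_n.-1.+1.

Definition pm n (A : {set Zmod n}) : {set Zmod n} :=
  A :|: [set - x | x in A].

(* For P = {x, y} with x <> y this is {x - y, y - x, x + y}; its image under  *)
(* pm is therefore +-{x - y, x + y}.                                          *)
Definition diffsum n (P : {set Zmod n}) : {set Zmod n} :=
  [set x - y | x in P, y in P :\ x] :|: [set x + y | x in P, y in P :\ x].

Definition is_PS v (S : {set {set Zmod v}}) : Prop :=
  [/\ (v %% 4 = 1)%N,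
      #|S| = ((v - 1) %/ 4)%N,
      (forall P, P \in S -> #|P| = 2%N),
      \bigcup_(P in S) pm P = ~: [set 0]
    & \bigcup_(P in S) pm (diffsum P) = ~: [set 0]].

Definition is_APS v (alpha beta : Zmod v) (S : {set {set Zmod v}}) : Prop :=
  [/\ (v %% 4 = 3)%N /\ (alpha <> 0 /\ beta <> 0),
      #|S| = ((v - 3) %/ 4)%N,
      (forall P, P \in S -> #|P| = 2%N),
      \bigcup_(P in S) pm P = ~: [set 0; alpha; - alpha]
    & \bigcup_(P in S) pm (diffsum P) = ~: [set 0; beta; - beta]].

(* Multisets are sequences up to permutation.                                 *)
Definition Delta1 n (B : {set Zmod n}) : seq (Zmod n) :=
  [seq x - y | x <- enum B, y <- enum (B :\ x)].

Definition Delta n (BB : {set {set Zmod n}}) : seq (Zmod n) :=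
  flatten [seq Delta1 B | B <- enum BB].

Definition is_OOC n k (BB : {set {set Zmod n}}) : Prop :=
  (forall B, B \in BB -> #|B| = k) /\ uniq (Delta BB).

Definition is_maximum_OOC n k (BB : {set {set Zmod n}}) : Prop :=
  is_OOC k BB /\ (#|[set d | d \notin Delta BB]| <= k * (k - 1))%N.

(* Main.v *)
(** Since [m] is coprime to [v], [Z_(mv)] is identified with [Z_m x Z_v]. A pair
    [{x, y}] is turned into the codeword [{(0,x), (0,-x), (1,y), (1,-y)}] when
    [m = 3], and into [{(0,0), (1,x), (1,-x), (-1,y), (-1,-y)}] when [m = 5].
    In [{0} x Z_v] its differences are [+-2x, +-2y]; in each other class they are
    [+-x +- y], or [+-x, +-y] (this only in the classes [+-1] for [m = 5]).
    Hence the (A)PS property makes the differences cover every class except for at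
    most 3 elements. The number [k(k-1)] of differences of a codeword is exactly
    [4m], so a count shows that the covering has no repetition. *)
Require Import Defs.
From mathcomp Require Import all_boot all_order all_algebra.
From mathcomp Require Import zify.

Set Implicit Arguments.
Unset Strict Implicit.
Unset Printing Implicit Defensive.

Import GRing.Theory.
Local Open Scope ring_scope.

(** * Counting differences, and a covering criterion for maximum codes *)

Lemma size_Delta1 n (B : {set Zmod n}) : size (Delta1 B) = (#|B| * #|B|.-1)%N.
Proof.
rewrite /Delta1 size_allpairs_dep sumnE big_map.
under eq_big_seq => x xB.
  rewrite -cardE (_ : #|B :\ x| = #|B|.-1); last first.
    by move: xB; rewrite mem_enum => xB; rewrite (cardsD1 x B) xB.
  over.
by rewrite big_const_seq iter_addn_0 count_predT -cardE mulnC.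
Qed.

Lemma size_Delta n (BB : {set {set Zmod n}}) :
  size (Delta BB) = (\sum_(B in BB) #|B| * #|B|.-1)%N.
Proof.
rewrite /Delta size_flatten /shape -map_comp sumnE big_map big_enum_cond /=.
by apply: eq_big => [B|B _]; rewrite ?andbT ?size_Delta1.
Qed.

Lemma mem_Delta n (BB : {set {set Zmod n}}) B u w :
  B \in BB -> u \in B -> w \in B -> u != w -> u - w \in Delta BB.
Proof.
move=> BBB uB wB neq_uw; apply/flattenP; exists (Delta1 B).
  by apply: map_f; rewrite mem_enum.
by apply: allpairs_f_dep; rewrite mem_enum // !inE eq_sym neq_uw.
Qed.

(** A squeeze: [Delta BB] has at most [#|BB| * (k * (k - 1))] entries, yet it contains the at least
    as many elements of [D]. So nothing repeats, and equality in the count forces every codeword to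
    have exactly [k] elements. *)
Lemma maximum_OOC_of_cover n k (BB : {set {set Zmod n}}) (D : {set Zmod n}) :
  (1 < k)%N -> (forall B, B \in BB -> #|B| <= k)%N ->
  {subset D <= Delta BB} -> (#|BB| * (k * (k - 1)) <= #|D|)%N ->
  (#|~: D| <= k * (k - 1))%N -> is_maximum_OOC k BB.
Proof.
move=> k1 leBk sDBB leBBD leDC.
have le_term B : B \in BB -> (#|B| * #|B|.-1 <= k * (k - 1))%N.
  by move=> /leBk leB; rewrite leq_mul //; lia.
have le_size : (size (Delta BB) <= #|BB| * (k * (k - 1)))%N.
  by rewrite size_Delta -sum_nat_const leq_sum.
have uD : uniq (Delta BB).
  apply: (@leq_size_uniq _ (enum D)); first exact: enum_uniq.
    by move=> d; rewrite mem_enum => /sDBB.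
  by rewrite -cardE (leq_trans le_size).
split; last first.
  apply: leq_trans leDC; apply/subset_leq_card/subsetP => d; rewrite !inE.
  by apply: contra => /sDBB.
split=> // B BBB.
have geD : (#|D| <= size (Delta BB))%N.
  by rewrite cardE uniq_leq_size ?enum_uniq // => d; rewrite mem_enum => /sDBB.
have := leq_trans leBBD geD.
rewrite size_Delta -sum_nat_const (bigD1 B) //= [leqRHS](bigD1 B) //=.
have : (\sum_(i in BB | i != B) #|i| * #|i|.-1
        <= \sum_(i in BB | i != B) k * (k - 1))%N.
  by apply: leq_sum => i /andP[/le_term].
(* A codeword with fewer than [k] elements would make its term strictly smaller than [k * (k - 1)];
   for the empty codeword this uses [1 < k]. *)
move=> le_rest le_sum; apply/eqP; rewrite eqn_leq leBk //= leqNgt.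
apply/negP => lt_Bk.
have := leq_trans le_sum (leq_add (leqnn _) le_rest); rewrite leq_add2r.
by apply/negP; rewrite -ltnNge ltn_mul //; lia.
Qed.

(** * Chinese remainder identification and the count over classes *)

Lemma inZp_sub p q (u w : 'I_q.+1) : (p.+1 %| q.+1)%N ->
  inZp (u - w : 'I_q.+1)%R = inZp u - inZp w :> 'I_p.+1.
Proof.
move=> dvd_pq; have inZpD (t : 'I_q.+1) :
    inZp (t + w : 'I_q.+1)%R = inZp t + inZp w :> 'I_p.+1.
  by apply: val_inj; rewrite /= modn_dvdm // modnDml modnDmr.
by apply/eqP; rewrite eq_sym subr_eq -inZpD subrK.
Qed.

Section CRT.
Variables m v : nat.
Hypotheses (m0 : (0 < m)%N) (v0 : (0 < v)%N) (co_mv : coprime m v).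

Definition residues (w : Zmod (m * v)) : Zmod m * Zmod v := (inZp w, inZp w).

Let mv0 : (0 < m * v)%N. Proof. by rewrite muln_gt0 m0. Qed.

Lemma residues_sub u w : residues (u - w) = residues u - residues w.
Proof.
rewrite /residues !inZp_sub // !prednK //; first exact: dvdn_mull.
exact: dvdn_mulr.
Qed.

Lemma residues_inj : injective residues.
Proof.
move=> u w [/eqP + /eqP]; rewrite (prednK m0) (prednK v0) => eq_m eq_v.
have := chinese_remainder co_mv u w; rewrite eq_m eq_v => /eqP eq_mv.
have lt_mv (z : Zmod (m * v)) : (z < m * v)%N by rewrite -{2}(prednK mv0).
by apply: val_inj; rewrite /= -(modn_small (lt_mv u)) eq_mv modn_small.
Qed.

Lemma residues_surj c : exists w, residues w = c.
Proof.
have [|g _ gK] := inj_card_bij residues_inj; last by exists (g c).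
by rewrite card_prod !card_ord !prednK.
Qed.

(** Here [L P] lists the codeword of [P] in residues, and [X c] holds the differences that may be
    missed in class [c]. Since [4m * #|S| + m * r = m * v], the codewords have just enough
    differences for the rest. Only upper bounds are asked of [L P] and [X c]: that the listed
    entries are distinct follows from the count. *)
Lemma maximum_OOC_of_classes k r (S : {set {set Zmod v}})
    (L : {set Zmod v} -> seq (Zmod m * Zmod v)) (X : Zmod m -> {set Zmod v}) :
  (k * (k - 1) = 4 * m)%N -> (4 * #|S| + r = v)%N -> (r <= 4)%N ->
  (forall c, #|X c| <= r)%N -> 0 \in X 0 -> (forall P, size (L P) <= k)%N ->
  (forall c z, z \notin X c ->
     exists P u w, [/\ P \in S, u \in L P, w \in L P & (c, z) = u - w]) ->
  exists BB : {set {set Zmod (m * v)}}, is_maximum_OOC k BB.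
Proof.
move=> kE vE r4 leX X0 sizeL coverL.
pose b P := [set w | residues w \in L P].
pose D := [set d | (residues d).2 \notin X (residues d).1].
(* The complement of [D] embeds into the union [Y] of the slices [{c} x X c], each of size at most
   [r]. *)
have leDC : (#|~: D| <= m * r)%N.
  rewrite -(card_imset _ residues_inj).
  pose Y := \bigcup_c [set (c, z) | z in X c].
  apply: (@leq_trans #|Y|).
    apply/subset_leq_card/subsetP => _ /imsetP[d + ->]; rewrite !inE negbK => dX.
    by apply/bigcupP; exists (residues d).1 => //; apply/imsetP; exists (residues d).2.
  apply: leq_trans (_ : \sum_c #|[set (c, z) | z in X c]| <= _)%N.
    rewrite /Y; elim/big_ind2: _ => //; first by rewrite cards0.
    by move=> A a B c leA leB; rewrite (leq_trans (leq_card_setU _ _)) ?leq_add.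
  apply: leq_trans (_ : \sum_(c : Zmod m) r <= _)%N.
    by apply: leq_sum => c _; rewrite (leq_trans (leq_imset_card _ _)).
  by rewrite sum_nat_const card_ord prednK.
have cardD : (#|D| + #|~: D| = m * v)%N by rewrite cardsC card_ord prednK.
exists (b @: S); apply: (maximum_OOC_of_cover (D := D)).
- by case: k kE {sizeL} => [|[|k]]; rewrite ?muln0 //; lia.
- move=> _ /imsetP[P _ ->]; rewrite -(card_imset _ residues_inj).
  apply: leq_trans (sizeL P); apply: leq_trans (card_size (L P)).
  by apply/subset_leq_card/subsetP => _ /imsetP[w + ->]; rewrite inE.
- move=> d; rewrite inE => /[dup] dX /coverL[P [u [w [PS uL wL]]]].
  have [u' eu] := residues_surj u; have [w' ew] := residues_surj w.
  rewrite -eu -ew -residues_sub => /residues_inj dE; rewrite dE in dX *.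
  apply: (@mem_Delta _ _ (b P)); rewrite ?inE ?eu ?ew ?imset_f //.
  (* Equal [u'] and [w'] would give the difference zero, which [0 \in X 0] keeps out of [D]. *)
  by apply: contraNneq dX => ->; rewrite residues_sub subrr X0.
(* Injectivity of [b] on [S] is not at stake here: [#|b @: S| <= #|S|] suffices. *)
- rewrite kE; apply: (@leq_trans (4 * m * #|S|)%N).
    by rewrite mulnC leq_mul2l leq_imset_card orbT.
  rewrite -(leq_add2r #|~: D|).
  have <- : (4 * m * #|S| + m * r = #|D| + #|~: D|)%N.
    by rewrite cardD -[RHS](congr1 (muln m) vE) mulnDr mulnCA mulnA.
  by rewrite leq_add2l.
- by rewrite kE (leq_trans leDC) // mulnC leq_mul2r r4 orbT.
Qed.

End CRT.

(** * From PS and APS to explicit pairs with signs *)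

(* A common form of PS (r = 1) and APS (r = 3), with explicit choices of the
   two members of each pair. *)
Definition covering_pairs v r (S : {set {set Zmod v}}) (E F : {set Zmod v})
    (x y : {set Zmod v} -> Zmod v) : Prop :=
  [/\ (4 * #|S| + r = v)%N, (r <= 3)%N, (#|E| <= r)%N /\ (#|F| <= r)%N, 0 \in E
    & (forall z, z \notin E -> exists2 P, P \in S &
         (z \in [:: x P; - x P]) || (z \in [:: y P; - y P])) /\
      (forall z, z \notin F -> exists P s t,
         [/\ P \in S, s \in [:: x P; - x P], t \in [:: y P; - y P]
           & z = s + t])].

Lemma covering_pairs_of_bigcup v r (S : {set {set Zmod v}}) (E F : {set Zmod v}) :
  (4 * #|S| + r = v)%N -> (r <= 3)%N -> (#|E| <= r)%N -> (#|F| <= r)%N ->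
  0 \in E -> (forall P, P \in S -> #|P| = 2%N) ->
  \bigcup_(P in S) pm P = ~: E -> \bigcup_(P in S) pm (diffsum P) = ~: F ->
  exists x y, covering_pairs r S E F x y.
Proof.
move=> vE r3 leE leF E0 card2 coverE coverF.
(* The default [0] is never reached for [P \in S], whose enumeration has length 2. *)
pose x (P : {set Zmod v}) := nth 0 (enum P) 0.
pose y (P : {set Zmod v}) := nth 0 (enum P) 1.
have PE P : P \in S -> P = [set x P; y P].
  move=> /card2; rewrite cardE /x /y => sizeP.
  apply/setP => z; rewrite -[in LHS]mem_enum !inE.
  by case: (enum P) sizeP => [|a [|c []]] //; rewrite !inE.
exists x, y; split=> //; split=> z.
  rewrite -in_setC -coverE => /bigcupP[P PS zP]; exists P => //.
  move: zP; rewrite [P in pm P](PE P PS) !inE.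
  case/orP=> [/orP[] /eqP->|/imsetP[t]]; rewrite ?eqxx ?orbT //.
  by rewrite !inE => /orP[] /eqP-> ->; rewrite eqxx ?orbT.
rewrite -in_setC -coverF => /bigcupP[P PS zP].
(* Each of these three values, and each of their negatives, has the form [s + t] with [s] one of
   [x P], [- x P] and [t] one of [y P], [- y P]. *)
have diffsumP t : t \in diffsum P ->
    [|| t == x P + y P, t == x P - y P | t == y P - x P].
  rewrite [P in diffsum P](PE P PS) inE.
  case/orP=> /imset2P[a c]; rewrite !inE => aP /andP[+ cP] ->.
    by case/orP: aP cP => /eqP-> /orP[] /eqP->; rewrite ?eqxx ?orbT.
  by case/orP: aP cP => /eqP-> /orP[] /eqP->; rewrite ?eqxx // addrC eqxx.
have sumP s t : s \in [:: x P; - x P] -> t \in [:: y P; - y P] ->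
    z = s + t -> exists P' s' t', [/\ P' \in S, s' \in [:: x P'; - x P'],
      t' \in [:: y P'; - y P'] & z = s' + t'].
  by move=> *; exists P, s, t; split.
move: zP; rewrite inE => /orP[/diffsumP|/imsetP[t /diffsumP + tE]].
  by case/or3P=> /eqP zE; [apply: (sumP (x P) (y P)) | apply: (sumP (x P) (- y P))
    | apply: (sumP (- x P) (y P))]; rewrite ?inE ?eqxx ?orbT ?zE // addrC.
by case/or3P=> /eqP zE; [apply: (sumP (- x P) (- y P)) | apply: (sumP (- x P) (y P))
    | apply: (sumP (x P) (- y P))];
  rewrite ?inE ?eqxx ?orbT ?tE ?zE ?opprD ?opprK // addrC.
Qed.

Lemma covering_pairs_PS_APS v : (0 < v)%N ->
  (exists S : {set {set Zmod v}}, is_PS S) \/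
  (exists (alpha beta : Zmod v) (S : {set {set Zmod v}}), is_APS alpha beta S) ->
  exists r S E F x y, @covering_pairs v r S E F x y.
Proof.
have card3 (a : Zmod v) : (#|[set 0; a; - a]%R| <= 3)%N.
  apply: leq_trans (leq_card_setU _ _) _; rewrite cards1.
  by rewrite cards2; case: (_ == _).
move=> v0 [[S [vmod cardS card2 coverE coverF]]|].
  exists 1%N, S, [set 0], [set 0].
  by apply: covering_pairs_of_bigcup; rewrite ?cards1 ?inE //; lia.
move=> [alpha [beta [S [[vmod _] cardS card2 coverE coverF]]]].
exists 3%N, S, [set 0; alpha; - alpha], [set 0; beta; - beta].
by apply: covering_pairs_of_bigcup; rewrite ?card3 ?inE ?eqxx //; lia.
Qed.

(** * Halving for odd [v], and the two families of codewords *)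

Lemma Zmod_half v (z : Zmod v) : odd v -> exists t, z = t + t.
Proof.
(* The multiplier [v./2.+1] is (v+1)/2, the inverse of 2 modulo [v]. *)
move=> odd_v; exists (z *+ v./2.+1).
have v0 : (0 < v)%N by case: v odd_v {z}.
rewrite -mulrnDr (_ : (_ + _)%N = v.+1); last by lia.
rewrite mulrS -[X in z *+ X](prednK v0) (_ : z *+ v.-1.+1 = 0) ?addr0 //.
by rewrite Zp_mulrn; apply: val_inj; rewrite /= modnMl.
Qed.

(** For class 0: the half [t] of [z] lies outside [E], so covering makes it a signed member of some
    pair, and [t], [- t] are second coordinates of one codeword. *)
Lemma notin_double v (E : {set Zmod v}) z : odd v ->
  z \notin [set t + t | t in E] -> exists2 t, z = t - - t & t \notin E.
Proof.
move=> odd_v; have [t ->] := Zmod_half z odd_v => ztE.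
by exists t; rewrite ?opprK //; apply: contra ztE => tE; apply/imsetP; exists t.
Qed.

Lemma mem_opp_pair (A : zmodType) (s a : A) :
  s \in [:: a; - a] -> - s \in [:: a; - a].
Proof. by rewrite !inE => /orP[] /eqP->; rewrite ?opprK eqxx ?orbT. Qed.

Lemma pair_sub (A B : zmodType) (a a' : A) (b b' : B) :
  (a, b) - (a', b') = (a - a', b - b').
Proof. by []. Qed.

Lemma maximum_OOC_4_of_covering_pairs v r S E F x y :
  odd v -> coprime 3 v -> @covering_pairs v r S E F x y ->
  exists BB : {set {set Zmod (3 * v)}}, is_maximum_OOC 4 BB.
Proof.
move=> odd_v co_3v [vE r3 [leE leF] E0 [coverE coverF]].
pose L P : seq (Zmod 3 * Zmod v) :=
  [seq (0, s) | s <- [:: x P; - x P]] ++ [seq (1, t) | t <- [:: y P; - y P]].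
(* Differences in class 0 are doubles of pair members, so they miss at most the doubles of [E]; the
   classes 1 and -1 hold signed sums and miss at most [F]. *)
pose X (c : Zmod 3) := if c == 0 then [set t + t | t in E] else F.
apply: (@maximum_OOC_of_classes 3 v _ _ _ 4 r S L X) => //.
- by case: (v) odd_v.
- exact: leqW.
- by move=> c; rewrite /X; case: eqP; rewrite // (leq_trans (leq_imset_card _ _)).
- by rewrite /X eqxx; apply/imsetP; exists 0; rewrite ?addr0.
have Lx P s : s \in [:: x P; - x P] -> (0, s) \in L P.
  by move=> sP; rewrite mem_cat map_f.
have Ly P t : t \in [:: y P; - y P] -> (1, t) \in L P.
  by move=> tP; rewrite mem_cat orbC map_f.
move=> c z; rewrite /X; have [-> zX|c0 /coverF[P [s [t [PS sP tP ->]]]]] := eqVneq c 0.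
  have [t -> /coverE[P PS /orP[tP|tP]]] := notin_double odd_v zX.
    by exists P, (0, t), (0, - t); rewrite pair_sub subrr !Lx ?mem_opp_pair.
  by exists P, (1, t), (1, - t); rewrite pair_sub subrr !Ly ?mem_opp_pair.
(* Both lists of signs are closed under negation, so [s + t] is [t - (- s)] in class 1 and
   [s - (- t)] in class -1. *)
have [->|->] : c = 1 \/ c = - 1.
  by case: c c0 => [[|[|[|//]]] lt_c] // _; [left|right]; apply: val_inj.
  exists P, (1, t), (0, - s); rewrite pair_sub subr0 opprK addrC.
  by rewrite Lx ?Ly ?mem_opp_pair.
exists P, (0, s), (1, - t); rewrite pair_sub sub0r opprK.
by rewrite Lx ?Ly ?mem_opp_pair.
Qed.

Lemma maximum_OOC_5_of_covering_pairs v r S E F x y :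
  odd v -> coprime 5 v -> @covering_pairs v r S E F x y ->
  exists BB : {set {set Zmod (5 * v)}}, is_maximum_OOC 5 BB.
Proof.
move=> odd_v co_5v [vE r3 [leE leF] E0 [coverE coverF]].
pose L P : seq (Zmod 5 * Zmod v) :=
  (0, 0) :: [seq (1, s) | s <- [:: x P; - x P]] ++
            [seq (- 1, t) | t <- [:: y P; - y P]].
(* The classes 1 and -1 contain the differences with [(0, 0)], hence the exception set [E]; signed
   sums fall in the classes 2 and -2. *)
pose X (c : Zmod 5) :=
  if c == 0 then [set t + t | t in E] else if c \in [:: 1; - 1] then E else F.
apply: (@maximum_OOC_of_classes 5 v _ _ _ 5 r S L X) => //.
- by case: (v) odd_v.
- exact: leqW.
- move=> c; rewrite /X; case: eqP => _; last by case: ifP.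
  by rewrite (leq_trans (leq_imset_card _ _)).
- by rewrite /X eqxx; apply/imsetP; exists 0; rewrite ?addr0.
have L0 P : (0, 0) \in L P by rewrite inE eqxx.
have Lx P s : s \in [:: x P; - x P] -> (1, s) \in L P.
  by move=> sP; rewrite inE mem_cat map_f ?orbT.
have Ly P t : t \in [:: y P; - y P] -> (- 1, t) \in L P.
  by move=> tP; rewrite inE mem_cat (map_f _ tP) !orbT.
move=> c z; rewrite /X; have [-> zX|c0] := eqVneq c 0.
  have [t -> /coverE[P PS /orP[tP|tP]]] := notin_double odd_v zX.
    by exists P, (1, t), (1, - t); rewrite pair_sub subrr !Lx ?mem_opp_pair.
  by exists P, (- 1, t), (- 1, - t); rewrite pair_sub subrr !Ly ?mem_opp_pair.
have [c1 /coverE[P PS zP]|c1 /coverF[P [s [t [PS sP tP ->]]]]] := ifP.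
  (* In class 1, signed [x P] come from subtracting [(0, 0)] and signed [y P] from subtracting a
     point of class -1 from [(0, 0)]; in class -1 the two roles are exchanged. *)
  move: c1; rewrite !inE => /orP[] /eqP->; case/orP: zP => zP.
  - by exists P, (1, z), (0, 0); rewrite pair_sub !subr0 L0 Lx.
  - by exists P, (0, 0), (- 1, - z); rewrite pair_sub !sub0r !opprK L0 Ly ?mem_opp_pair.
  - by exists P, (0, 0), (1, - z); rewrite pair_sub !sub0r !opprK L0 Lx ?mem_opp_pair.
  - by exists P, (- 1, z), (0, 0); rewrite pair_sub !subr0 L0 Ly.
have [->|->] : c = 1 - - 1 \/ c = - 1 - 1.
  by case: c c0 c1 => [[|[|[|[|[|//]]]]] lt_c] // _ _; [left|right]; apply: val_inj.
  by exists P, (1, s), (- 1, - t); rewrite pair_sub (opprK t) Lx ?Ly ?mem_opp_pair.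
exists P, (- 1, t), (1, - s); rewrite pair_sub (opprK s) (addrC t).
by rewrite Lx ?Ly ?mem_opp_pair.
Qed.

Local Close Scope ring_scope.

Theorem theorem6p1 (v : nat) :
  (exists S : {set {set Zmod v}}, is_PS S) \/
  (exists (alpha beta : Zmod v) (S : {set {set Zmod v}}), is_APS alpha beta S) ->
  (gcdn v 6 = 1 ->
     exists BB : {set {set Zmod (3 * v)}}, is_maximum_OOC 4 BB) /\
  (gcdn v 10 = 1 ->
     exists BB : {set {set Zmod (5 * v)}}, is_maximum_OOC 5 BB).
Proof.
move=> PSv; split=> gcd_v.
  (* Oddness serves the halving in class 0, coprimality to 3 the Chinese remainder step. *)
  have /andP[odd_v co_v3] : odd v && coprime v 3.
    by rewrite -coprimen2 -coprimeMr /coprime gcd_v.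
  have [r [S [E [F [x [y]]]]]] := covering_pairs_PS_APS (odd_gt0 odd_v) PSv.
  by apply: maximum_OOC_4_of_covering_pairs; rewrite // coprime_sym.
have /andP[odd_v co_v5] : odd v && coprime v 5.
  by rewrite -coprimen2 -coprimeMr /coprime gcd_v.
have [r [S [E [F [x [y]]]]]] := covering_pairs_PS_APS (odd_gt0 odd_v) PSv.
by apply: maximum_OOC_5_of_covering_pairs; rewrite // coprime_sym.
Qed.
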